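(* Let $\mathcal{C}$ be a crystal framework in $\mathbb{R}^d$ with a given periodic structure and associated geometric flex spectrum $\Gamma(\mathcal{C})$. Then $\mathcal{F}(\mathcal{C};\mathbb{C})$ is finite-dimensional if and only if $\Gamma(\mathcal{C})$ is a finite set.
   Context: A crystal framework $\mathcal{C}=(G,p)$ in $\mathbb{R}^d$ ($d\ge2$): $G=(V,E)$ a countable simple graph, $p:V\to\mathbb{R}^d$ injective, with a periodic structure $a_1,\dots,a_d$ (linearly independent) such that $\mathbb{Z}^d$ acts on $G$ by automorphisms $v\mapsto k\cdot v$ with $p(k\cdot v)=p(v)+\sum_ik_ia_i$, having finitely many vertex and edge orbits. Choose a motif: vertex orbit representatives $F_v=\{v_1,\dots,v_n\}$ and $m$ edge orbit representatives $F_e$; write $(v,k)=k\cdot v$, each motif edge as $e=(v,k)(w,l)$, $v,w\in F_v$, and $p(e)=p(v,k)-p(w,l)$. $\mathcal{F}(\mathcal{C};\mathbb{C})$ is the complex vector space of maps $u:V\to\mathbb{C}^d$ with $(u(x)-u(y))\cdot(p(x)-p(y))=0$ for all edges $xy\in E$. The transfer function $\Psi_{\mathcal{C}}(z)$, $z\in\mathbb{C}_*^d=(\mathbb{C}\setminus\{0\})^d$, is the $m\times dn$ matrix whose row for $e=(v,k)(w,l)$, $v\neq w$, has $p(e)z^{-k}$ in the $d$ columns of $v$, $-p(e)z^{-l}$ in those of $w$, zeros elsewhere, and for $v=w$ has $p(e)(z^{-k}-z^{-l})$ in the columns of $v$ ($z^k=z_1^{k_1}\cdots z_d^{k_d}$).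 The geometric flex spectrum is $\Gamma(\mathcal{C})=\{\omega\in\mathbb{C}_*^d:\ker\Psi_{\mathcal{C}}(\omega^{-1})\ne\{0\}\}$, where $\omega^{-1}=(\omega_1^{-1},\dots,\omega_d^{-1})$. *)

(* Defs.v *)
From HB Require Import structures.
From mathcomp Require Import all_boot all_order all_algebra.
From mathcomp Require Import reals.
From mathcomp Require Export complex.
Set Implicit Arguments. Unset Strict Implicit. Unset Printing Implicit Defensive.
Import Order.TTheory GRing.Theory Num.Theory.
Local Open Scope ring_scope.

Section Crystal.
Variables (R : realType) (d : nat) (V : Type).

Definition lattice_vec (a : 'I_d -> 'rV[R]_d) (k : 'rV[int]_d) : 'rV[R]_d :=
  \sum_(i < d) (k 0 i)%:~R *: a i.

Definition crystal_framework (adj : V -> V -> Prop) (p : V -> 'rV[R]_d)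
    (a : 'I_d -> 'rV[R]_d) (act : 'rV[int]_d -> V -> V) : Prop :=
  [/\ (* V countable *) exists f : V -> nat, injective f,
      (* G simple *) (forall x y, adj x y -> adj y x) /\ (forall x, ~ adj x x),
      (* p injective *) injective p,
      (* a_1..a_d linearly independent *) row_free (\matrix_(i < d) a i) &
      (
      [/\ forall x, act 0 x = x,
          forall k l x, act (k + l) x = act k (act l x),
          forall k x y, adj x y <-> adj (act k x) (act k y) &
          forall k x, p (act k x) = p x + lattice_vec a k] /\
      (exists n (vr : 'I_n -> V), forall x, exists i k, x = act k (vr i)) /\
      (exists m (ex ey : 'I_m -> V), forall x y, adj x y -> exists j k,
          (x = act k (ex j) /\ y = act k (ey j)) \/
          (x = act k (ey j) /\ y = act k (ex j))))].

(* A motif: vertex orbit representatives vr : 'I_n -> V and m edge orbit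
   representatives, the j-th being the edge (vr (ev j), ek j)(vr (ew j), el j),
   i.e. between act (ek j) (vr (ev j)) and act (el j) (vr (ew j)). *)
Definition motif (adj : V -> V -> Prop) (act : 'rV[int]_d -> V -> V)
    (n m : nat) (vr : 'I_n -> V) (ev ew : 'I_m -> 'I_n) (ek el : 'I_m -> 'rV[int]_d)
    : Prop :=
  let ex j := act (ek j) (vr (ev j)) in
  let ey j := act (el j) (vr (ew j)) in
  [/\
      forall x, exists i k, x = act k (vr i),
      forall i i' k, act k (vr i) = vr i' -> i = i',
      forall j, adj (ex j) (ey j),
      forall x y, adj x y -> exists j k,
          (x = act k (ex j) /\ y = act k (ey j)) \/
          (x = act k (ey j) /\ y = act k (ex j)) &
      forall j j' k,
          (act k (ex j) = ex j' /\ act k (ey j) = ey j') \/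
          (act k (ex j) = ey j' /\ act k (ey j) = ex j') -> j = j'].

Definition flex_space (adj : V -> V -> Prop) (p : V -> 'rV[R]_d)
    (u : V -> 'rV[R[i]]_d) : Prop :=
  forall x y, adj x y ->
    \sum_(c < d) (u x 0 c - u y 0 c) * real_complex R (p x 0 c - p y 0 c) = 0.

Definition finite_dim_space (F : (V -> 'rV[R[i]]_d) -> Prop) : Prop :=
  exists (N : nat) (b : 'I_N -> V -> 'rV[R[i]]_d),
    (forall s, F (b s)) /\
    forall u, F u -> exists c : 'I_N -> R[i],
      forall x, u x = \sum_(s < N) c s *: b s x.

Definition zpow (z : 'rV[R[i]]_d) (k : 'rV[int]_d) : R[i] :=
  \prod_(i < d) (z 0 i) ^ (k 0 i).

(* The transfer function Psi_C(z): an m x dn matrix whose columns are indexed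
   by pairs (vertex representative v, coordinate c) via mxvec_index. *)
Definition transfer (p : V -> 'rV[R]_d) (act : 'rV[int]_d -> V -> V)
    (n m : nat) (vr : 'I_n -> V) (ev ew : 'I_m -> 'I_n) (ek el : 'I_m -> 'rV[int]_d)
    (z : 'rV[R[i]]_d) : 'M[R[i]]_(m, n * d) :=
  \matrix_(j < m) mxvec (\matrix_(v < n, c < d)
     let pe := real_complex R
       (p (act (ek j) (vr (ev j))) 0 c - p (act (el j) (vr (ew j))) 0 c) in
     if ev j != ew j then
       (if v == ev j then pe * zpow z (- ek j)
        else if v == ew j then - pe * zpow z (- el j) else 0)
     else
       (if v == ev j then pe * (zpow z (- ek j) - zpow z (- el j)) else 0)).

Definition flex_spectrum (p : V -> 'rV[R]_d) (act : 'rV[int]_d -> V -> V)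
    (n m : nat) (vr : 'I_n -> V) (ev ew : 'I_m -> 'I_n) (ek el : 'I_m -> 'rV[int]_d)
    (w : 'rV[R[i]]_d) : Prop :=
  (forall i, w 0 i != 0) /\
  exists u : 'cV[R[i]]_(n * d), u != 0 /\
    transfer p act vr ev ew ek el (map_mx GRing.inv w) *m u = 0.

Definition finite_set_of (T : eqType) (S : T -> Prop) : Prop :=
  exists s : seq T, forall x, S x -> x \in s.

End Crystal.

(* Main.v *)
(* Identify a flex with a functional on Laurent polynomials with values in C^(nd), encoded
by polynomials in x_1, ..., x_d and formal inverses, on which lattice translations act by
multiplication. The annihilator I of all flexes contains x_i x_i^-1 - 1 and, by Cramer's rule,
the maximal minors of the transfer matrix, so every zero of I gives a point of the flex
spectrum. If the spectrum is finite, then for all but finitely many z the element x_i - z is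
invertible modulo I (weak Nullstellensatz). As C is uncountable while the polynomial ring has
countable dimension, the inverses satisfy a nontrivial linear relation; clearing denominators
puts a nonzero univariate polynomial in x_i into I. Hence a flex is determined by its values
on a finite box. Conversely, a spectrum point w gives a flex that is an eigenvector of each
lattice translation with eigenvalue w_i; on a finite-dimensional flex space each translation
has finitely many eigenvalues, by Cayley-Hamilton. *)

Require Import Defs.
From HB Require Import structures.
From mathcomp Require Import all_boot all_order all_algebra.
From mathcomp Require Import reals complex boolp ssrcomplements mpoly.
From mathcomp Require Import ring lra zify.
Set Implicit Arguments. Unset Strict Implicit. Unset Printing Implicit Defensive.
Import Order.TTheory GRing.Theory Num.Theory.
Local Open Scope ring_scope.

(** * Uncountability of the real line, in the form of a pigeonhole for complex numbers *)

Section Uncountable.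
Variable R : realType.

(** The points are removed one at a time: the right half is kept if the point lies strictly left of
    the midpoint, and the left third otherwise. *)
Lemma subitv_avoiding (s : seq R) (a b : R) : a < b ->
  exists c e : R, [/\ a <= c, c < e, e <= b & forall x, x \in s -> ~~ (c <= x <= e)].
Proof.
move=> ab; elim: s => [|y s [c [e [ac ce eb ih]]]]; first by exists a, b.
have [yc|cy] := ltP y ((c + e) / 2).
  exists ((c + e) / 2), e; split => //; [by lra | by lra |].
  move=> x; rewrite inE => /orP[/eqP ->|/ih]; first by rewrite leNgt yc.
  by apply: contra => /andP[h1 h2]; apply/andP; split; lra.
exists c, (c + (e - c) / 3); split => //; [by lra | by lra |].
move=> x; rewrite inE => /orP[/eqP ->|/ih]; first by apply/negP => /andP[_ h]; lra.
by apply: contra => /andP[h1 h2]; apply/andP; split; lra.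
Qed.

(** Cantor's nested intervals: the interval of index [k.+1] misses [l k], and the supremum of the
    left endpoints lies in all of them. *)
Lemma countable_finite_union_proper (l : nat -> seq R) :
  exists z : R, forall k, z \notin l k.
Proof.
pose T := {ab : R * R | ab.1 < ab.2}.
have step (k : nat) (t : T) : exists t' : T,
    [/\ (sval t).1 <= (sval t').1, (sval t').2 <= (sval t).2 &
        forall x, x \in l k -> ~~ ((sval t').1 <= x <= (sval t').2)].
  case: t => -[a b] /= ab; have [c [e [h1 h2 h3 h4]]] := subitv_avoiding (l k) ab.
  by exists (exist _ (c, e) h2).
pose P (kt : nat * T) (t' : T) := [/\ (sval kt.2).1 <= (sval t').1,
  (sval t').2 <= (sval kt.2).2 &
  forall x, x \in l kt.1 -> ~~ ((sval t').1 <= x <= (sval t').2)].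
have [|f fP] := @choice _ _ P; first by case=> k t; exact: step.
pose t0 : T := exist (fun ab : R * R => ab.1 < ab.2) (0, 1) ltr01.
pose F := fix F k := if k is k'.+1 then f (k', F k') else t0.
have FP k := fP (k, F k).
have mono i j : (sval (F i)).1 <= (sval (F (i + j)%N)).1 /\
                (sval (F (i + j)%N)).2 <= (sval (F i)).2.
  elim: j => [|j [h1 h2]]; first by rewrite addn0.
  rewrite addnS /=; have [h3 h4 _] := FP (i + j)%N.
  by split; [exact: le_trans h1 h3 | exact: le_trans h4 h2].
have cross i j : (sval (F i)).1 <= (sval (F j)).2.
  have lt12 k : (sval (F k)).1 <= (sval (F k)).2 by case: (F k) => ab /= /ltW.
  have [ij|ji] := leqP i j.
    by have [h _] := mono i (j - i)%N; rewrite (subnKC ij) in h; exact: le_trans h (lt12 _).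
  by have [_ h] := mono j (i - j)%N; rewrite (subnKC (ltnW ji)) in h; exact: le_trans (lt12 _) h.
pose S : classical_sets.set R := fun x => exists k, x = (sval (F k)).1.
have S0 k : S (sval (F k)).1 by exists k.
have ubS k : classical_sets.ubound S (sval (F k)).2 by move=> _ [i ->]; exact: cross.
exists (sup S) => k; apply/negP => lk; have [_ _ /(_ _ lk)/negP] := FP k.
apply; apply/andP; split.
  by apply: (ub_le_sup _ (S0 k.+1)); exists (sval (F 0%N)).2; exact: ubS.
by apply: ge_sup; [exists (sval (F 0%N)).1; exact: S0 | exact: (ubS k.+1)].
Qed.

(** Otherwise each sublevel set of [g] outside [s] is finite, and countably many finite lists would
    exhaust the complex numbers; real test points already contradict this. *)
Lemma large_sublevel (s : seq R[i]) (g : R[i] -> nat) :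
  exists b, forall K, exists t : seq R[i],
    [/\ uniq t, size t = K & forall z, z \in t -> z \notin s /\ (g z <= b)%N].
Proof.
apply: contrapT => /forallNP H.
have fin b : exists l : seq R[i], forall z, z \notin s -> (g z <= b)%N -> z \in l.
  apply: contrapT => /forallNP nfin; apply: (H b); elim=> [|K [t [tu tK tP]]].
    by exists [::].
  have /existsNP[z] := nfin t; move=> /not_implyP[zs] /not_implyP[zb] /negP zt.
  exists (z :: t); split; rewrite /= ?zt ?tK // => y.
  by rewrite inE => /predU1P[->|/tP].
have [l lP] := choice fin.
have [z zP] := countable_finite_union_proper (fun k => map (@complex.Re R) (s ++ l k)).
have z0 k : (z%:C)%C \notin s ++ l k.
  by apply: contra (zP k) => h; apply/mapP; exists (z%:C)%C.
move: (z0 (g (z%:C)%C)); rewrite mem_cat negb_or => /andP[zs /negP]; apply.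
exact: lP.
Qed.

End Uncountable.

(** * Ideals of a commutative ring as predicates *)

Section Ideals.
Variable S : comNzRingType.

Definition is_ideal (J : S -> Prop) : Prop :=
  [/\ J 0, forall x y, J x -> J y -> J (x + y) & forall x y, J y -> J (x * y)].

Variables (J : S -> Prop) (iJ : is_ideal J).

Lemma ideal0 : J 0. Proof. by case: iJ. Qed.
Lemma idealD x y : J x -> J y -> J (x + y). Proof. by case: iJ => _ h _; apply: h. Qed.
Lemma idealMl x y : J y -> J (x * y). Proof. by case: iJ => _ _ h; apply: h. Qed.
Lemma idealMr x y : J x -> J (x * y). Proof. by rewrite mulrC; apply: idealMl. Qed.
Lemma idealB x y : J x -> J y -> J (x - y).
Proof. by move=> hx hy; rewrite -mulN1r; apply: idealD => //; apply: idealMl. Qed.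
Lemma ideal_sum (I : Type) (r : seq I) (P : pred I) (F : I -> S) :
  (forall i, P i -> J (F i)) -> J (\sum_(i <- r | P i) F i).
Proof. by move=> h; apply: big_ind => //; [exact: ideal0 | exact: idealD]. Qed.

Definition ideal_adjoin (a : S) : S -> Prop :=
  fun q => exists b, J (q - b * a).

Lemma ideal_adjoin_ideal a : is_ideal (ideal_adjoin a).
Proof.
split; first by exists 0; rewrite mul0r subr0; exact: ideal0.
  move=> x y [b hb] [c hc]; exists (b + c).
  by rewrite mulrDl opprD addrACA; apply: idealD.
by move=> x y [b hb]; exists (x * b); rewrite -mulrA -mulrBr; apply: idealMl.
Qed.

Lemma ideal_adjoin_sub a q : J q -> ideal_adjoin a q.
Proof. by exists 0; rewrite mul0r subr0. Qed.

Lemma ideal_adjoin_gen a : ideal_adjoin a a.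
Proof. by exists 1; rewrite mul1r subrr; exact: ideal0. Qed.

End Ideals.

(** * Weak Nullstellensatz over the complex numbers by counting dimensions *)

Section Nullstellensatz.
Variables (R : realType) (N : nat).
Local Notation C := (R[i]).
Local Notation A := {mpoly C[N]}.

Lemma ideal_univariate (J : A -> Prop) (x : A) (s : seq C) :
  is_ideal J ->
  (forall z, z \notin s -> ideal_adjoin J (x - z%:MP) 1) ->
  exists2 f : {poly C}, f != 0 & J (horner_alg x f).
Proof.
move=> iJ unitJ.
have [b0 b0P] : {b : C -> A & forall z, z \notin s -> J (1 - b z * (x - z%:MP))}.
  apply: (@choice _ _ (fun z b => z \notin s -> J (1 - b * (x - z%:MP)))) => z.
  have [zs|zs] := boolP (z \in s); first by exists 0.
  by have [b hb] := unitJ z zs; exists b.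
have [k kP] := large_sublevel s (fun z => msize (b0 z)).
pose I := 'X_{1..N < k}; pose D := #|{: I}|.
(* The [D] monomials of degree below [k] span all inverses of size at most [k], so [D.+1] such
   inverses are linearly dependent. *)
have [t [tu tD tP]] := kP D.+1.
pose lam (j : 'I_D.+1) := nth 0 t j.
have lamt j : lam j \in t by rewrite mem_nth ?tD.
have lam_inj : injective lam.
  by move=> i j /eqP; rewrite nth_uniq ?tD // => /eqP /val_inj.
pose M : 'M[C]_(D.+1, D) := \matrix_(j, m) (b0 (lam j))@_(enum_val m : I).
have [c c0 cM] : exists2 c : 'rV[C]_D.+1, c != 0 & c *m M = 0.
  have : kermx M != 0.
    by rewrite kermx_eq0 /row_free neq_ltn ltnS rank_leq_col.
  by case/rowV0Pn => c /sub_kermxP cM c0; exists c.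
have rel : \sum_j c 0 j *: b0 (lam j) = 0.
  transitivity (\sum_j \sum_(m : I) (c 0 j * (b0 (lam j))@_m) *: 'X_[m] : A).
    apply: eq_bigr => j _; rewrite {1}(@mpolywE _ _ k (b0 (lam j))).
      by rewrite scaler_sumr; apply: eq_bigr => m _; rewrite scalerA.
    by case: (tP _ (lamt j)).
  rewrite exchange_big big1 // => m _; rewrite -scaler_suml.
  have := congr1 (fun v : 'rV[C]_D => v 0 (enum_rank m)) cM.
  rewrite !mxE => h; rewrite (_ : \sum_(i < D.+1) _ = 0) ?scale0r //.
  by rewrite -[RHS]h; apply: eq_bigr => j _; rewrite mxE enum_rankK.
pose P j : {poly C} := \prod_(i | i != j) ('X - (lam i)%:P).
exists (\sum_j c 0 j *: P j).
  (* At [lam j0] every [P j] with [j] other than [j0] vanishes and [P j0] does not, as the [lam] are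
     distinct; this isolates the coefficient [c 0 j0]. *)
  apply/negP => /eqP f0; case/rV0Pn: c0 => j0 /negP; apply; apply/eqP.
  have := congr1 (fun p : {poly C} => p.[lam j0]) f0.
  rewrite /= horner0 horner_sum (bigD1 j0) //= [X in _ + X]big1 ?addr0 => [|j jj0].
    rewrite hornerZ /P horner_prod => /eqP; rewrite mulf_eq0 => /orP[/eqP //|/prodf_eq0[i ij]].
    by rewrite !hornerE subr_eq0 => /eqP /lam_inj e; rewrite e eqxx in ij.
  rewrite hornerZ horner_prod (bigD1 j0) 1?eq_sym //=.
  by rewrite hornerXsubC subrr mul0r mulr0.
have evX i : horner_alg x ('X - (lam i)%:P) = x - (lam i)%:MP.
  by rewrite rmorphB /= horner_algX horner_algC alg_mpolyC.
pose Q := horner_alg x (\prod_i ('X - (lam i)%:P)).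
(* By [rel], subtracting [b0 (lam j) * Q] from each term changes nothing in total, and turns each
   term into a multiple of an element of [J]. *)
have -> : horner_alg x (\sum_j c 0 j *: P j) =
    \sum_j c 0 j *: (horner_alg x (P j) * (1 - b0 (lam j) * (x - (lam j)%:MP))).
  transitivity (\sum_j c 0 j *: (horner_alg x (P j) - b0 (lam j) * Q)).
    rewrite linear_sum /=; under [RHS]eq_bigr do rewrite scalerBr scalerAl.
    rewrite sumrB -mulr_suml rel mul0r subr0; apply: eq_bigr => j _.
    by rewrite linearZ /= mulr_algl.
  apply: eq_bigr => j _; congr (_ *: _).
  rewrite /Q (bigD1 j) //= rmorphM /= evX -/(P j); ring.
apply: ideal_sum => // j _; rewrite -mul_mpolyC; apply: idealMl => //; apply: idealMl => //.
by apply: b0P; case: (tP _ (lamt j)).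
Qed.

(** If every [x - z] were invertible modulo [J], then [J] would contain some nonzero polynomial in
    [x]; it splits into linear factors, and cancelling these one by one leaves 1 in [J]. *)
Lemma ideal_proper_adjoin (J : A -> Prop) (x : A) :
  is_ideal J -> ~ J 1 -> exists z, ~ ideal_adjoin J (x - z%:MP) 1.
Proof.
move=> iJ J1; apply: contrapT => /forallNP unitJ.
have {}unitJ z : ideal_adjoin J (x - z%:MP) 1 by apply: contrapT; exact: unitJ.
have [f f0 Jf] := ideal_univariate (s := [::]) iJ (fun z _ => unitJ z).
apply: J1; have [r fE] := closed_field_poly_normal f.
have : J (horner_alg x (\prod_(z <- r) ('X - z%:P))).
  move: Jf; rewrite fE linearZ /= mulr_algl => /(idealMl iJ ((lead_coef f)^-1)%:MP).
  by rewrite mul_mpolyC scalerA mulVf ?lead_coef_eq0 // scale1r.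
elim: r {fE} => [|z r IH]; first by rewrite big_nil rmorph1.
rewrite big_cons rmorphM rmorphB /= horner_algX horner_algC alg_mpolyC => h.
apply: IH; have [b hb] := unitJ z; set q := horner_alg x _ in h *.
have -> : q = q * (1 - b * (x - z%:MP)) + b * ((x - z%:MP) * q) by ring.
by apply: idealD => //; apply: idealMl.
Qed.

(** The variables are specialised one after the other, keeping the ideal proper. In the final ideal
    [J'] each polynomial is congruent to its value at [z], so a nonzero value of an element of [J]
    would be a unit in [J']. *)
Lemma weak_nullstellensatz (J : A -> Prop) :
  is_ideal J -> ~ J 1 -> exists z : 'I_N -> C, forall q, J q -> q.@[z] = 0.
Proof.
move=> iJ J1.
have H k : (k <= N)%N -> exists J' : A -> Prop, [/\ is_ideal J', ~ J' 1,
    forall q, J q -> J' q & forall i : 'I_N, (i < k)%N -> exists z, J' ('X_i - z%:MP)].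
  elim: k => [|k IH] kN; first by exists J.
  have [J' [iJ' J'1 sJ hJ']] := IH (ltnW kN).
  have [z hz] := ideal_proper_adjoin 'X_(Ordinal kN) iJ' J'1.
  exists (ideal_adjoin J' ('X_(Ordinal kN) - z%:MP)); split => //.
  - exact: ideal_adjoin_ideal.
  - by move=> q /sJ; exact: ideal_adjoin_sub.
  move=> i; rewrite ltnS leq_eqVlt => /orP[/eqP ik|/hJ' [y hy]].
    exists z; rewrite (_ : i = Ordinal kN); last exact: val_inj.
    exact: ideal_adjoin_gen.
  by exists y; apply: ideal_adjoin_sub.
have [J' [iJ' J'1 sJ /(_ _ (ltn_ord _)) hJ']] := H N (leqnn N).
have [z zP] := choice hJ'.
exists z => q /sJ J'q.
have evJ (r : A) : J' (r - (r.@[z])%:MP).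
  have prodJ (a b : A) : J' (a - (a.@[z])%:MP) -> J' (b - (b.@[z])%:MP) ->
      J' (a * b - ((a * b).@[z])%:MP).
    move=> ha hb; rewrite rmorphM /= mpolyCM.
    have -> : a * b - (a.@[z])%:MP * (b.@[z])%:MP =
      (a - (a.@[z])%:MP) * b + (a.@[z])%:MP * (b - (b.@[z])%:MP) by ring.
    by apply: idealD => //; [apply: idealMr | apply: idealMl].
  rewrite [r]mpolyE; elim/big_rec: _ => [|m y _ hy].
    by rewrite meval0 mpolyC0 subrr; exact: ideal0.
  rewrite mevalD mpolyCD opprD addrACA; apply: idealD => // {y hy}.
  rewrite -mul_mpolyC; apply: (prodJ); first by rewrite mevalC subrr; exact: ideal0.
  rewrite mpolyXE_id.
  elim/big_rec: _ => [|i y _ hy]; first by rewrite meval1 mpolyC1 subrr; exact: ideal0.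
  apply: (prodJ) => //; elim: (m i) => [|e IH].
    by rewrite expr0 meval1 mpolyC1 subrr; exact: ideal0.
  by rewrite exprS; apply: (prodJ) => //; rewrite mevalXU.
apply: contrapT => /eqP qz; apply: J'1.
have : J' ((q.@[z])%:MP) by rewrite -[X in J' X](subKr q); apply: idealB.
by move=> /(idealMl iJ' ((q.@[z])^-1)%:MP); rewrite -mpolyCM mulVf // mpolyC1.
Qed.

End Nullstellensatz.

(** * Linear functionals on polynomials with prescribed values on monomials *)

Section MonomialFunctional.
Variables (C : comNzRingType) (N : nat) (g : 'X_{1..N} -> C).

Definition mlin (q : {mpoly C[N]}) : C := \sum_(m <- msupp q) q@_m * g m.

(** An index set independent of [q] allows sums for different polynomials to be compared term by
    term. *)
Lemma mlinwE k q : (msize q <= k)%N -> mlin q = \sum_(m : 'X_{1..N < k}) q@_m * g m.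
Proof.
move=> le_k; pose I : subFinType _ := 'X_{1..N < k}.
rewrite /mlin (big_mksub I) ?msupp_uniq //=; first last.
  by move=> m /msize_mdeg_lt /leq_trans; apply.
by rewrite big_rmcond //= => m /memN_msupp_eq0 ->; rewrite mul0r.
Qed.

Lemma mlin_is_scalar : scalar mlin.
Proof.
move=> c q r; pose k := maxn (msize (c *: q + r)) (maxn (msize q) (msize r)).
rewrite !(@mlinwE k) /k ?leq_max ?leqnn ?orbT // mulr_sumr -big_split /=.
by apply: eq_bigr => m _; rewrite mcoeffD mcoeffZ mulrDl mulrA.
Qed.

HB.instance Definition _ :=
  GRing.isLinear.Build C {mpoly C[N]} C *%R mlin mlin_is_scalar.

Lemma mlinX m : mlin 'X_[m] = g m.
Proof. by rewrite /mlin msuppX big_seq1 mcoeffX eqxx mul1r. Qed.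

Lemma mlinZ c q : mlin (c *: q) = c * mlin q.
Proof. exact: linearZ. Qed.

End MonomialFunctional.

(** * Finite dimension from finitely many separating coordinates *)

Section FiniteDimension.
Variables (R : realType) (d : nat) (V : Type) (F : (V -> 'rV[R[i]]_d) -> Prop).
Hypothesis FB : forall u v c, F u -> F v -> F (fun x => u x - c *: v x).

Lemma finite_dim_of_separating (T : finType) (h : T -> V * 'I_d) :
  (forall u, F u -> (forall t, u (h t).1 0 (h t).2 = 0) -> forall x, u x = 0) ->
  finite_dim_space F.
Proof.
move=> sepF.
(* Induction on the list [s] of coordinates allowed to be nonzero: each new coordinate adds at most
   one vector [u0] to the spanning family, and a multiple of [u0] clears that coordinate. *)
have H (s : seq T) : finite_dim_space (fun u => F u /\
    forall t, t \notin s -> u (h t).1 0 (h t).2 = 0).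
  elim: s => [|t0 s [N [b [Fb spanb]]]].
    exists 0%N, (fun _ _ => 0); split=> [[] //|u [Fu u0]].
    exists (fun=> 0) => x; rewrite big_ord0; apply: sepF => // t; exact: u0.
  have [[u0 [Fu0 zu0] nz]|] := EM (exists2 u0 : V -> 'rV[R[i]]_d,
      F u0 /\ (forall t, t \notin t0 :: s -> u0 (h t).1 0 (h t).2 = 0) &
      u0 (h t0).1 0 (h t0).2 <> 0); last first.
    move=> H; exists N, b; split=> [j|u [Fu zu]].
      by have [Fj zj] := Fb j; split=> // t; rewrite inE negb_or => /andP[_ /zj].
    apply: spanb; split=> // t ts; have [->|tt0] := eqVneq t t0; last first.
      by apply: zu; rewrite inE negb_or tt0.
    by apply: contrapT => h0; apply: H; exists u.
  exists N.+1, (fun j => if unlift ord0 j is Some j' then b j' else u0); split.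
    move=> j; case: unliftP => [j' _|_] //.
    by have [Fj zj] := Fb j'; split=> // t; rewrite inE negb_or => /andP[_ /zj].
  move=> u [Fu zu]; pose c0 := u (h t0).1 0 (h t0).2 / u0 (h t0).1 0 (h t0).2.
  have [|c cP] := spanb (fun x => u x - c0 *: u0 x).
    split; first exact: FB.
    move=> t ts; have [->|tt0] := eqVneq t t0.
      by rewrite !mxE /c0 divfK ?subrr //; apply/eqP.
    by rewrite !mxE zu ?zu0 ?mulr0 ?subr0 // inE negb_or tt0.
  exists (fun j => if unlift ord0 j is Some j' then c j' else c0) => x.
  rewrite big_ord_recl unlift_none; under eq_bigr do rewrite liftK.
  by rewrite -cP addrC subrK.
have [N [b [Fb spanb]]] := H (enum T).
exists N, b; split=> [j|u Fu]; first by case: (Fb j).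
by apply: spanb; split=> // t; rewrite mem_enum.
Qed.

End FiniteDimension.

(** * Auxiliary facts on sums, minors, finite sets and roots *)

Lemma sum_mxvec_index (S : nmodType) (n d : nat) (F : 'I_(n * d) -> S) :
  \sum_w F w = \sum_v \sum_c F (mxvec_index v c).
Proof.
rewrite pair_bigA /= (reindex (uncurry (@mxvec_index n d))) /=; last first.
  by have [g gK Kg] := curry_mxvec_bij n d; exists g => x _; [exact: gK|exact: Kg].
by apply: eq_bigr => -[].
Qed.

Lemma sum_deltaM (S : pzRingType) (T : finType) (a : T) (F : T -> S) :
  \sum_v (v == a)%:R * F v = F a.
Proof.
by rewrite (bigD1 a) //= eqxx mul1r big1 ?addr0 // => v /negPf ->; rewrite mul0r.
Qed.

(** A matrix of full column rank has [N] rows forming an invertible square matrix; short of full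
    column rank, the kernel is nonzero. *)
Lemma kernel_of_minors_eq0 (C : fieldType) (m N : nat) (M : 'M[C]_(m, N)) :
  (forall f : 'I_N -> 'I_m, \det (rowsub f M) = 0) ->
  exists u : 'cV[C]_N, u != 0 /\ M *m u = 0.
Proof.
move=> minors0.
have [fM|nfM] := boolP (row_full M).
  by have := fullrowsub_unit fM; rewrite unitmxE minors0 unitr0.
have : kermx M^T != 0.
  by rewrite kermx_eq0 /row_free mxrank_tr.
case/rowV0Pn => c /sub_kermxP cM c0; exists c^T; split.
  by rewrite -trmx0 (inj_eq trmx_inj).
by apply: trmx_inj; rewrite trmx_mul trmxK cM trmx0.
Qed.

Lemma finite_rows (C : choiceType) (d : nat) (r : 'I_d -> seq C) :
  exists s : seq 'rV[C]_d, forall w : 'rV[C]_d, (forall i, w 0 i \in r i) -> w \in s.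
Proof.
pose s := flatten [seq r i | i <- enum 'I_d].
exists [seq (\row_i val (f i)) | f : {ffun 'I_d -> seq_sub s} <- enum predT] => w wr.
have ws i : w 0 i \in s.
  by apply/flattenP; exists (r i) => //; apply: map_f; rewrite mem_enum.
apply/mapP; exists [ffun i => SeqSub (ws i)]; first by rewrite mem_enum.
by apply/rowP => i; rewrite mxE ffunE.
Qed.

Lemma closed_field_roots (C : closedFieldType) (q : {poly C}) : q != 0 ->
  exists r : seq C, forall z, root q z -> z \in r.
Proof.
move=> q0; have [r qE] := closed_field_poly_normal q; exists r => z.
by rewrite qE rootZ ?lead_coef_eq0 // root_prod_XsubC.
Qed.

(** * Laurent monomials encoded by ordinary monomials in twice as many variables *)

Section LaurentMonomials.
Variables (R : realType) (d : nat).
Local Notation A := {mpoly R[i][d + d]}.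

(* The first d variables are x_1, ..., x_d and the last d play the role of their inverses. *)
Definition mnm_shift (m : 'X_{1..d + d}) : 'rV[int]_d :=
  \row_i ((m (lshift d i))%:Z - (m (rshift d i))%:Z).

Definition shift_mnm (k : 'rV[int]_d) : 'X_{1..d + d} :=
  [multinom match split i with
            | inl j => if (0 <= k 0%R j)%R then absz (k 0%R j) else 0%N
            | inr j => if (0 <= k 0%R j)%R then 0%N else absz (k 0%R j)
            end | i < d + d].

Lemma shift_mnmK : cancel shift_mnm mnm_shift.
Proof.
move=> k; apply/rowP => i; rewrite mxE !mnmE.
rewrite (unsplitK (inl i : 'I_d + 'I_d)) (unsplitK (inr i : 'I_d + 'I_d)).
by case: ifP; lia.
Qed.

Lemma mnm_shiftD m1 m2 : mnm_shift (m1 + m2)%MM = mnm_shift m1 + mnm_shift m2.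
Proof. by apply/rowP => i; rewrite !mxE !mnmDE !PoszD; ring. Qed.

Lemma mnm_shiftV i : mnm_shift (U_(lshift d i) + U_(rshift d i))%MM = 0.
Proof.
apply/rowP => j; rewrite !mxE !mnmDE !mnm1E.
by rewrite !(inj_eq (@lshift_inj _ _)) !(inj_eq (@rshift_inj _ _)) eq_lrshift eq_rlshift addn0 subrr.
Qed.

(** The value is the power [k] of the first half of [z]; it is written through inverses to match the
    entries of the transfer matrix at the inverted point. *)
Lemma meval_shift_mnm (z : 'I_(d + d) -> R[i]) (k : 'rV[int]_d) :
  (forall i, z (lshift d i) * z (rshift d i) = 1) ->
  ('X_[shift_mnm k] : A).@[z] =
    zpow (map_mx GRing.inv (\row_i z (lshift d i))) (- k).
Proof.
move=> zV; rewrite mevalX big_split_ord /= -big_split /=; apply: eq_bigr => i _.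
rewrite !mnmE (unsplitK (inl i : 'I_d + 'I_d)) (unsplitK (inr i : 'I_d + 'I_d)) !mxE.
have zE : z (rshift d i) = (z (lshift d i))^-1 by apply/esym/mulr1_eq.
rewrite zE exprz_inv opprK.
case: (k 0 i) => q /=; first by rewrite expr0 mulr1.
by rewrite expr0 mul1r exprVn.
Qed.

End LaurentMonomials.

(** * The flex equations and flexes as functionals on polynomials *)

Section Motif.
Variables (R : realType) (d : nat) (V : Type).
Variables (adj : V -> V -> Prop) (p : V -> 'rV[R]_d) (a : 'I_d -> 'rV[R]_d).
Variables (act : 'rV[int]_d -> V -> V).
Variables (n m : nat) (vr : 'I_n -> V) (ev ew : 'I_m -> 'I_n).
Variables (ek el : 'I_m -> 'rV[int]_d).
Hypothesis crystalC : crystal_framework adj p a act.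
Hypothesis motifC : motif adj act vr ev ew ek el.
Local Notation C := (R[i]).
Local Notation A := {mpoly C[d + d]}.

Lemma actD k l x : act (k + l) x = act k (act l x).
Proof. by case: crystalC => _ _ _ _ [[]]. Qed.

Definition edge_vec (j : 'I_m) (c : 'I_d) : C := real_complex R
  (p (act (ek j) (vr (ev j))) 0 c - p (act (el j) (vr (ew j))) 0 c).

Lemma edge_vec_act k j c : real_complex R
    (p (act k (act (ek j) (vr (ev j)))) 0 c - p (act k (act (el j) (vr (ew j)))) 0 c)
  = edge_vec j c.
Proof.
case: crystalC => _ _ _ _ [[_ _ _ pact] _].
rewrite 2!(pact k) /edge_vec; move: (lattice_vec a k) => l.
by rewrite !mxE; congr (real_complex R _); ring.
Qed.

(** Every edge is a translate of a motif edge, and the lattice vector cancels in the difference of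
    its end positions. Reversing an edge changes both signs. *)
Lemma flex_spaceE (u : V -> 'rV[C]_d) : flex_space adj p u <->
  forall k j, \sum_c (u (act (k + ek j) (vr (ev j))) 0 c -
                      u (act (k + el j) (vr (ew j))) 0 c) * edge_vec j c = 0.
Proof.
have [_ _ _ _ [[_ _ adjact _] _]] := crystalC.
have [_ _ edgeC edges _] := motifC.
split=> [Fu k j|Fu x y /edges[j [k [[-> ->]|[-> ->]]]]].
- have /Fu := (adjact k _ _).1 (edgeC j).
  by under eq_bigr do rewrite edge_vec_act; rewrite !actD.
- by under eq_bigr do rewrite edge_vec_act; rewrite -!actD.
rewrite -[RHS](Fu k j); apply: eq_bigr => c _.
by rewrite -(edge_vec_act k) !actD -mulrNN opprB -rmorphN opprB.
Qed.

(** Kronecker deltas treat edges within one vertex orbit and edges between two orbits by a single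
    formula. *)
Lemma transferE z j v c :
  transfer p act vr ev ew ek el z j (mxvec_index v c) =
  edge_vec j c * ((v == ev j)%:R * zpow z (- ek j) - (v == ew j)%:R * zpow z (- el j)).
Proof.
rewrite !mxE mxvecE !mxE -/(edge_vec j c).
have [->|ne] := eqVneq (ev j) (ew j); rewrite /=.
  by case: eqVneq => _ /=; ring.
have [->|_] := eqVneq v (ev j); first by rewrite (negPf ne) /=; ring.
by case: eqVneq => _ /=; ring.
Qed.

Lemma transfer_rowE z (b : 'I_n -> 'I_d -> C) j :
  \sum_w transfer p act vr ev ew ek el z j w * mxvec (\matrix_(v, c) b v c) 0 w =
  \sum_c (zpow z (- ek j) * b (ev j) c - zpow z (- el j) * b (ew j) c) * edge_vec j c.
Proof.
rewrite sum_mxvec_index exchange_big; apply: eq_bigr => c _ /=.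
rewrite -(sum_deltaM (ev j) (fun v => zpow z (- ek j) * b v c)).
rewrite -(sum_deltaM (ew j) (fun v => zpow z (- el j) * b v c)).
rewrite -sumrB mulr_suml; apply: eq_bigr => v _; rewrite transferE mxvecE mxE; ring.
Qed.

(** The transfer matrix at the inverse of an indeterminate point: the entry power with exponent
    [- ek j] becomes the monomial of [ek j]. *)
Definition laurent_transfer : 'M[A]_(m, n * d) :=
  \matrix_(j < m) mxvec (\matrix_(v < n, c < d)
     ((edge_vec j c)%:MP * ((v == ev j)%:R * 'X_[shift_mnm (ek j)]
                            - (v == ew j)%:R * 'X_[shift_mnm (el j)]))).

Definition flex_coords (u : V -> 'rV[C]_d) (k : 'rV[int]_d) : 'rV[C]_(n * d) :=
  mxvec (\matrix_(v, c) u (act k (vr v)) 0 c).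

(** Multiplying the argument by ['X_[mm]] amounts to translating [u] by [mnm_shift mm]. *)
Definition flex_functional (u : V -> 'rV[C]_d) (w : 'I_(n * d)) : A -> C :=
  mlin (fun mm => flex_coords u (mnm_shift mm) 0 w).

Lemma flex_functionalX u w mm : flex_functional u w 'X_[mm] = flex_coords u (mnm_shift mm) 0 w.
Proof. exact: mlinX. Qed.

Lemma flex_functional_eq0 u w (Q : A) :
  (forall mm, flex_functional u w (Q * 'X_[mm]) = 0) ->
  forall P, flex_functional u w (Q * P) = 0.
Proof.
move=> H P; rewrite [P]mpolyE mulr_sumr /flex_functional linear_sum big1 //= => mm _.
by rewrite -scalerAr mlinZ [X in _ * X]H mulr0.
Qed.

(** For a monomial [P] this is the flex equation of the [j]-th motif edge translated by the exponent
    of [P]; the general case follows by linearity. *)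
Lemma flex_functional_row u : flex_space adj p u -> forall j P,
  \sum_w flex_functional u w (laurent_transfer j w * P) = 0.
Proof.
move=> /flex_spaceE Fu j P.
rewrite [P]mpolyE; under eq_bigr do rewrite mulr_sumr [flex_functional _ _ _]linear_sum.
rewrite exchange_big big1 // => mm _ /=.
under eq_bigr do rewrite -scalerAr mlinZ.
rewrite -mulr_sumr [X in _ * X](_ : _ = 0) ?mulr0 //.
rewrite -[RHS](Fu (mnm_shift mm) j) sum_mxvec_index exchange_big; apply: eq_bigr => c _ /=.
rewrite -(sum_deltaM (ev j) (fun v => u (act (mnm_shift mm + ek j) (vr v)) 0 c)).
rewrite -(sum_deltaM (ew j) (fun v => u (act (mnm_shift mm + el j) (vr v)) 0 c)).
rewrite -sumrB mulr_suml; apply: eq_bigr => v _; rewrite !mxE mxvecE mxE.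
have -> : (edge_vec j c)%:MP * ((v == ev j)%:R * 'X_[shift_mnm (ek j)]
           - (v == ew j)%:R * 'X_[shift_mnm (el j)]) * 'X_[mm] =
  (edge_vec j c * (v == ev j)%:R) *: 'X_[mm + shift_mnm (ek j)] -
  (edge_vec j c * (v == ew j)%:R) *: 'X_[mm + shift_mnm (el j)] :> A.
  rewrite -!mul_mpolyC !mpolyCM !mpolyC_nat !mpolyXD; ring.
rewrite linearB /= !mlinZ !mlinX /flex_coords !mxvecE !mxE !mnm_shiftD !shift_mnmK; ring.
Qed.

(** * The annihilator of the flexes, its zeros, and finite dimension *)

Definition flex_ann (Q : A) : Prop :=
  forall u, flex_space adj p u -> forall w P, flex_functional u w (Q * P) = 0.

(** The arbitrary factor [P] in [flex_ann] absorbs multiplication, which is what makes it an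
    ideal. *)
Lemma flex_ann_ideal : is_ideal flex_ann.
Proof.
split=> [u Fu w P|Q Q' hQ hQ' u Fu w P|Q Q' hQ' u Fu w P].
- by rewrite mul0r /flex_functional linear0.
- by rewrite mulrDl /flex_functional linearD [X in X + _]hQ // [X in _ + X]hQ' // addr0.
- by rewrite mulrAC mulrC [_ * P]mulrC; apply: hQ'.
Qed.

Lemma flex_ann_inverse i : flex_ann ('X_(lshift d i) * 'X_(rshift d i) - 1).
Proof.
move=> u Fu w; apply: flex_functional_eq0 => mm.
rewrite mulrBl mul1r -!mpolyXD /flex_functional linearB /= !mlinX.
by rewrite mnm_shiftD mnm_shiftV add0r subrr.
Qed.

(** Cramer's rule: the adjugate combines the row relations of [flex_functional_row] into one that
    involves the coordinate [w] alone, with the minor as coefficient. *)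
Lemma flex_ann_minor (f : 'I_(n * d) -> 'I_m) : flex_ann (\det (rowsub f laurent_transfer)).
Proof.
move=> u Fu w P; set S := rowsub f _.
transitivity (\sum_w' flex_functional u w' ((\adj S *m S) w w' * P)).
  rewrite mul_adj_mx (bigD1 w) //= mxE eqxx mulr1n big1 ?addr0 // => w' ne.
  by rewrite mxE eq_sym (negPf ne) mulr0n mul0r /flex_functional linear0.
transitivity (\sum_w' \sum_j flex_functional u w' (laurent_transfer (f j) w' * (\adj S w j * P))).
  apply: eq_bigr => w' _; rewrite mxE mulr_suml [LHS]linear_sum; apply: eq_bigr => j _ /=.
  by congr (flex_functional u w' _); rewrite [S _ _]mxE -mulrA mulrCA.
by rewrite exchange_big big1 // => j _; apply: flex_functional_row.
Qed.

Lemma flex_spectrum_of_zero (z : 'I_(d + d) -> C) :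
  (forall Q, flex_ann Q -> Q.@[z] = 0) ->
  flex_spectrum p act vr ev ew ek el (\row_i z (lshift d i)) /\
  forall i, z (rshift d i) = (z (lshift d i))^-1.
Proof.
move=> annz.
have zV i : z (lshift d i) * z (rshift d i) = 1.
  have := annz _ (flex_ann_inverse i).
  by rewrite mevalB mevalM !mevalXU meval1 => /eqP; rewrite subr_eq0 => /eqP.
split; last by move=> i; apply/esym/mulr1_eq.
split=> [i|].
  by rewrite mxE; apply: contra_eq_neq (zV i) => ->; rewrite mul0r eq_sym oner_neq0.
apply: kernel_of_minors_eq0 => f.
have := annz _ (flex_ann_minor f); rewrite -det_map_mx map_mxsub => <-.
congr (\det (rowsub f _)); apply/matrixP => j w; case/mxvec_indexP: w => v c.
rewrite transferE !mxE mxvecE mxE /= mevalM mevalB !mevalM mevalC !rmorph_nat.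
by rewrite !meval_shift_mnm.
Qed.

(** The exceptional values for [ideal_univariate] are the [i]-th coordinates of the spectrum points,
    inverted for a formal inverse: if adjoining ['X_i - y] leaves a proper ideal, a common zero
    gives a spectrum point with that coordinate [y]. *)
Lemma flex_ann_univariate (i : 'I_(d + d)) :
  finite_set_of (flex_spectrum p act vr ev ew ek el) ->
  exists2 f : {poly C}, f != 0 & flex_ann (horner_alg 'X_i f).
Proof.
case=> s sP.
pose coord (w : 'rV[C]_d) := match split i with inl j => w 0 j | inr j => (w 0 j)^-1 end.
apply: (@ideal_univariate _ _ _ _ (map coord s) flex_ann_ideal) => y ys.
apply: contrapT => proper.
have [z zP] := weak_nullstellensatz (ideal_adjoin_ideal flex_ann_ideal _) proper.
have [zG zV] : flex_spectrum p act vr ev ew ek el (\row_i z (lshift d i)) /\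
    forall i, z (rshift d i) = (z (lshift d i))^-1.
  by apply: flex_spectrum_of_zero => Q annQ; apply/zP/ideal_adjoin_sub.
have ziy : z i = y.
  have := zP _ (ideal_adjoin_gen flex_ann_ideal _).
  by rewrite mevalB mevalXU mevalC => /eqP; rewrite subr_eq0 => /eqP.
move/negP: ys; apply; apply/mapP; exists (\row_i z (lshift d i)); first exact: sP.
by rewrite -ziy /coord; case: split_ordP => j ->; rewrite !mxE.
Qed.

(** Division by the univariate relations: outside the box some relation, times a monomial, expresses
    the value at [mm] by values at monomials of lower total degree. *)
Lemma flex_functional_box D u w : flex_space adj p u ->
  (forall i, exists f : {poly C}, [/\ f != 0, ((size f).-1 <= D)%N &
     flex_ann (horner_alg 'X_i f)]) ->
  (forall mm : 'X_{1..d + d}, (forall i, (mm i < D)%N) ->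
     flex_functional u w 'X_[mm] = 0) ->
  forall mm, flex_functional u w 'X_[mm] = 0.
Proof.
move=> Fu annf box mm; have [N] := ubnP (mdeg mm); elim: N mm => // N IH mm.
rewrite ltnS => degmm.
have [/forallP lt_D|/forallPn [i0]] := boolP [forall i, (mm i < D)%N]; first exact: box.
rewrite -leqNgt => le_D; have [f [f0 szf annfi]] := annf i0.
(* Here [e] is the degree of [f], and [e <= D <= mm i0] makes the truncated subtraction exact. *)
pose e := (size f).-1; pose mm' := (mm - U_(i0) *+ e)%MM.
have mmE : (mm' + U_(i0) *+ e)%MM = mm.
  rewrite submK //; apply/mnm_lepP => j; rewrite mulmnE mnm1E.
  by case: eqVneq => [<-|_]; rewrite ?mul0n // mul1n; apply: leq_trans le_D.
have := annfi u Fu w 'X_[mm'].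
have -> : horner_alg 'X_i0 f * 'X_[mm'] =
    \sum_(k < (size f)) f`_k *: 'X_[mm' + U_(i0) *+ k] :> A.
  rewrite -[in LHS](coefK f) poly_def linear_sum mulr_suml; apply: eq_bigr => k _ /=.
  rewrite linearZ /= mulr_algl rmorphXn /= horner_algX mpolyXn mpolyXD -scalerAl.
  by rewrite mulrC.
have szE : size f = e.+1 by rewrite /e prednK // lt0n size_poly_eq0.
rewrite szE big_ord_recr /= mmE [flex_functional _ _ _]linearD [X in X + _]linear_sum /=.
rewrite big1 => [|k _].
  rewrite add0r mlinZ => /eqP; rewrite mulf_eq0 => /orP[|/eqP //].
  by rewrite -[e]/(size f).-1 -lead_coefE lead_coef_eq0 (negPf f0).
rewrite mlinZ [X in _ * X]IH ?mulr0 //; apply: leq_trans degmm.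
by rewrite -mmE !mdegD !mdegMn mdeg1 !mul1n ltn_add2l.
Qed.

Lemma finite_dim_of_finite_spectrum :
  finite_set_of (flex_spectrum p act vr ev ew ek el) ->
  finite_dim_space (flex_space adj p).
Proof.
move=> finG.
have [f fP] : {f : 'I_(d + d) -> {poly C} &
    forall i, f i != 0 /\ flex_ann (horner_alg 'X_i (f i))}.
  apply: (@choice _ _ (fun i q => q != 0 /\ flex_ann (horner_alg 'X_i q))) => i.
  by have [q q0 annq] := flex_ann_univariate i finG; exists q.
pose D := (\max_i (size (f i)).-1)%N.
have annf i : exists q : {poly C}, [/\ q != 0, ((size q).-1 <= D)%N &
     flex_ann (horner_alg 'X_i q)].
  by have [q0 annq] := fP i; exists (f i); split=> //; exact: (leq_bigmax i).
(* The separating coordinates: a vertex orbit, an exponent with all entries below [D], and a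
   direction. *)
pose box (t : 'I_n * {ffun 'I_(d + d) -> 'I_D} * 'I_d) : V * 'I_d :=
  (act (mnm_shift [multinom (t.1.2 i : nat) | i < d + d]) (vr t.1.1), t.2).
apply: (@finite_dim_of_separating _ _ _ _ _ _ box).
- move=> u v c Fu Fv x y xy.
  transitivity (\sum_(i < d) (u x 0 i - u y 0 i) * real_complex R (p x 0 i - p y 0 i) -
    c * \sum_(i < d) (v x 0 i - v y 0 i) * real_complex R (p x 0 i - p y 0 i)).
    rewrite mulr_sumr -sumrB; apply: eq_bigr => i _; rewrite !mxE; ring.
  by rewrite Fu // Fv // mulr0 subr0.
move=> u Fu u0 x; case: motifC => /(_ x) [v [k ->]] _ _ _ _.
apply/rowP => c; rewrite mxE.
have /(_ _ (shift_mnm k)) := @flex_functional_box D u (mxvec_index v c) Fu annf.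
rewrite flex_functionalX /flex_coords shift_mnmK mxvecE mxE; apply=> mm mmD.
rewrite flex_functionalX /flex_coords mxvecE mxE.
have := u0 (v, [ffun i => Ordinal (mmD i)], c); rewrite /box /=.
rewrite (_ : [multinom _ | i < d + d] = mm) //.
by apply/mnmP => i; rewrite mnmE ffunE.
Qed.

(** * Flexes from spectrum points, and finiteness of the spectrum *)

Lemma zpowD (w : 'rV[C]_d) (k l : 'rV[int]_d) : (forall i, w 0 i != 0) ->
  zpow w (k + l) = zpow w k * zpow w l.
Proof.
move=> w0; rewrite /zpow -big_split; apply: eq_bigr => i _ /=.
by rewrite mxE expfzDr.
Qed.

Lemma zpow_inv (w : 'rV[C]_d) (k : 'rV[int]_d) :
  zpow (map_mx GRing.inv w) (- k) = zpow w k.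
Proof. by apply: eq_bigr => i _; rewrite !mxE exprz_inv opprK. Qed.

Lemma zpow_delta (w : 'rV[C]_d) i : zpow w (delta_mx 0 i) = w 0 i.
Proof.
rewrite /zpow (bigD1 i) //= mxE !eqxx expr1z big1 ?mulr1 // => j /negPf ji.
by rewrite mxE ji andbF expr0z.
Qed.

(** The orbit representatives fix [v]; then positions of the two translates agree, and linear
    independence of the periods fixes [k]. *)
Lemma act_vr_inj k l v v' : act k (vr v) = act l (vr v') -> k = l /\ v = v'.
Proof.
have [_ _ _ afree [[act0 _ _ pact] _]] := crystalC.
have [_ vrinj _ _ _] := motifC.
move=> E; have vv' : v = v'.
  by apply: (vrinj v v' (- l + k)); rewrite actD E -actD addNr act0.
split=> //; move: (congr1 p E); rewrite -vv' !pact => /addrI lkl.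
have : (\row_i ((k 0 i)%:~R - (l 0 i)%:~R : R)) *m (\matrix_(i < d) a i) = 0.
  rewrite mulmx_sum_row; under eq_bigr do rewrite mxE rowK scalerBl.
  by rewrite sumrB; apply/eqP; rewrite subr_eq0; apply/eqP.
move=> /eqP; rewrite mulmx_free_eq0 // => /eqP kl0.
apply/rowP => i; have := congr1 (fun r : 'rV[R]_d => r 0 i) kl0.
by rewrite !mxE => /eqP; rewrite subr_eq0 eqr_int => /eqP.
Qed.

(* The flex is (v, k) |-> w^k b_v for a kernel vector b of the transfer matrix. *)
Lemma flex_of_spectrum w : flex_spectrum p act vr ev ew ek el w ->
  exists u : V -> 'rV[C]_d, [/\ flex_space adj p u, exists x, u x != 0 &
    forall k x, u (act k x) = zpow w k *: u x].
Proof.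
case=> w0 [b [b0 Tb]].
pose bm : 'M[C]_(n, d) := vec_mx b^T.
have [orep orepP] : {o : V -> 'I_n * 'rV[int]_d & forall x, x = act (o x).2 (vr (o x).1)}.
  apply: (@choice _ _ (fun x o => x = act o.2 (vr o.1))) => x.
  by case: motifC => /(_ x) [v [k xE]] _ _ _ _; exists (v, k).
pose u x := zpow w (orep x).2 *: row (orep x).1 bm.
have uE k v : u (act k (vr v)) = zpow w k *: row v bm.
  by rewrite /u; have [<- <-] := act_vr_inj (orepP (act k (vr v))).
exists u; split.
- apply/flex_spaceE => k j.
  (* The flex equation in cell [k] is the [j]-th kernel equation scaled by the common factor
     [zpow w k]. *)
  transitivity (zpow w k * (transfer p act vr ev ew ek el (map_mx GRing.inv w) *m b) j 0); last first.
    by rewrite Tb mxE mulr0.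
  rewrite mxE; under [in RHS]eq_bigr => i _.
    rewrite (_ : b i 0 = mxvec (\matrix_(v, c) bm v c) 0 i); last first.
      by rewrite (_ : \matrix_(v, c) bm v c = bm) ?vec_mxK ?mxE //; apply/matrixP => v c; rewrite mxE.
    over.
  rewrite transfer_rowE !zpow_inv mulr_sumr; apply: eq_bigr => c _.
  rewrite !uE !zpowD // !mxE; ring.
- have bm0 : bm != 0.
    apply: contra_neq b0 => bm0; apply: trmx_inj; rewrite trmx0 -[b^T]vec_mxK.
    by rewrite -/bm bm0 linear0.
  have /matrix0Pn [v [c bvc]] := bm0.
  exists (act 0 (vr v)); rewrite uE; apply: contra_neq bvc => /(congr1 (fun r : 'rV[C]_d => r 0 c)).
  by rewrite !mxE /zpow big1 ?mul1r // => i _; rewrite mxE expr0z.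
move=> k x; by rewrite {1}[x]orepP -actD uE zpowD // -scalerA.
Qed.

Lemma finite_spectrum_of_finite_dim :
  finite_dim_space (flex_space adj p) ->
  finite_set_of (flex_spectrum p act vr ev ew ek el).
Proof.
(* Square matrices form a nontrivial ring only in positive size; an empty spanning family leaves
   only the zero flex, hence an empty spectrum. *)
case=> -[|N] [b [Fb spanb]].
  exists [::] => w /flex_of_spectrum [u [/spanb[c uE] [x]]].
  by rewrite uE big_ord0 eqxx.
pose B x : 'M[C]_(N.+1, d) := \matrix_s b s x.
(* [M i] expresses the translates of the family [b] through [b] itself; the family may be dependent,
   so [M i] is a choice. *)
have [M MP] : {M : 'I_d -> 'M[C]_N.+1 &
    forall i x, B (act (delta_mx 0 i) x) = M i *m B x}.
  apply: (@choice _ _ (fun i M => forall x, B (act (delta_mx 0 i) x) = M *m B x)) => i.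
  have shiftF s : flex_space adj p (fun x => b s (act (delta_mx 0 i) x)).
    move/flex_spaceE: (Fb s) => Fs; apply/flex_spaceE => k j.
    by rewrite -[RHS](Fs (delta_mx 0 i + k) j) -!addrA !actD.
  have [c cP] := choice (fun s => spanb _ (shiftF s)).
  exists (\matrix_(s, t) c s t) => x; apply/row_matrixP => s.
  rewrite rowK cP row_mul mulmx_sum_row; apply: eq_bigr => t _.
  by rewrite rowK !mxE.
have [r rP] := choice (fun i =>
  @closed_field_roots C (char_poly (M i)) (monic_neq0 (char_poly_monic (M i)))).
have [s sP] := finite_rows r; exists s => w /flex_of_spectrum [u [Fu [x ux] uact]].
apply: sP => i; apply: rP; have [c cP] := spanb u Fu.
have uB y : u y = (\row_s c s) *m B y.
  by rewrite cP mulmx_sum_row; apply: eq_bigr => t _; rewrite rowK mxE.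
(* On the eigenvector [u] the matrix polynomial acts by the scalar [q.[w 0 i]]; for the
   characteristic polynomial this scalar must vanish because [u x] is nonzero. *)
have ev_eigen (q : {poly C}) y : (\row_s c s) *m horner_mx (M i) q *m B y = q.[w 0 i] *: u y.
  elim/poly_ind: q y => [|q e IH] y; first by rewrite rmorph0 mulmx0 mul0mx horner0 scale0r.
  rewrite rmorphD rmorphM /= horner_mx_X horner_mx_C mulmxDr mulmxDl hornerMXaddC.
  rewrite mul_mx_scalar -scalemxAl -uB scalerDl; congr (_ + _).
  by rewrite mulmxA -(mulmxA _ (M i)) -MP IH uact zpow_delta scalerA.
have := ev_eigen (char_poly (M i)) x.
rewrite Cayley_Hamilton mulmx0 mul0mx => /esym/eqP.
by rewrite scaler_eq0 (negPf ux) orbF.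
Qed.

End Motif.

Theorem theorem3p5 (R : realType) (d : nat) (V : Type)
    (adj : V -> V -> Prop) (p : V -> 'rV[R]_d) (a : 'I_d -> 'rV[R]_d)
    (act : 'rV[int]_d -> V -> V)
    (n m : nat) (vr : 'I_n -> V) (ev ew : 'I_m -> 'I_n)
    (ek el : 'I_m -> 'rV[int]_d) :
  (2 <= d)%N ->
  crystal_framework adj p a act ->
  motif adj act vr ev ew ek el ->
  finite_dim_space (flex_space adj p) <->
  finite_set_of (flex_spectrum p act vr ev ew ek el).
Proof.
move=> _ crystalC motifC; split.
- exact: finite_spectrum_of_finite_dim crystalC motifC.
- exact: finite_dim_of_finite_spectrum crystalC motifC.
Qed.
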